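(* Let $\mathbb{K}$ be a field. Let $G=\langle x_1,\dots,x_n\mid r_1,\dots,r_m\rangle$ be a commutator-relators group (all $r_k\in[\mathbb{F}(n),\mathbb{F}(n)]$) with $H_2(G)$ torsion-free, and let $M$ be the linearized Alexander matrix of this presentation. Then, for every $0\le d\le n$, \[ \mathcal{R}_d(G,\mathbb{K})=\{\lambda\in\mathbb{K}^n\mid \operatorname{rank}_{\mathbb{K}} M(\lambda)<n-d\}. \]
   Context: $\mathbb{F}(n)$ is the free group on $x_1,\dots,x_n$. A commutator-relators group is a group with a finite presentation $\langle x_1,\dots,x_n\mid r_1,\dots,r_m\rangle$ with all $r_k\in[\mathbb{F}(n),\mathbb{F}(n)]$; then $G/G_2=\mathbb{Z}^n$ with basis $t_1,\dots,t_n$, $t_i$ the class of $x_i$, and $H^1(G,\mathbb{K})$ is identified with $\mathbb{K}^n$ via the dual basis $e_1,\dots,e_n$. Resonance varieties: $\mathcal{R}_d(G,\mathbb{K})$ is the set of $\lambda\in H^1(G,\mathbb{K})$ for which there is a subspace $W\subset H^1(G,\mathbb{K})$ with $\dim W=d+1$ and $\lambda\cup w=0$ in $H^2(G,\mathbb{K})$ for all $w\in W$. (Group cohomology is that of $K(G,1)$.) Linearized Alexander matrix: let $\epsilon:\mathbb{Z}\mathbb{F}(n)\to\mathbb{Z}$ be the augmentation, and let $\partial_i:\mathbb{Z}\mathbb{F}(n)\to\mathbb{Z}\mathbb{F}(n)$ be the Fox derivatives: additive, $\partial_i(1)=0$, $\partial_i(x_j)=\delta_{ij}$, $\partial_i(uv)=\partial_i(u)\epsilon(v)+u\,\partial_i(v)$.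 Let $\alpha:\mathbb{Z}\mathbb{F}(n)\to\mathbb{Z}[t_1^{\pm1},\dots,t_n^{\pm1}]$ be induced by $x_i\mapsto t_i$. The Alexander matrix is the $m\times n$ matrix with $(k,i)$ entry $\alpha(\partial_i r_k)$. Substituting $t_i=1+s_i$ (and $t_i^{-1}=\sum_{q\ge0}(-1)^q s_i^q$) and taking the homogeneous part of degree $1$ in $s_1,\dots,s_n$ of each entry gives $M$, an $m\times n$ matrix of integral linear forms; equivalently $M_{k,j}=\sum_{i=1}^n\epsilon(\partial_i\partial_j r_k)\,s_i$. For $\lambda\in\mathbb{K}^n$, $M(\lambda)$ is the matrix over $\mathbb{K}$ obtained by evaluating at $s=\lambda$. *)

(* Defs.v *)
From HB Require Import structures.
From mathcomp Require Import all_boot all_order all_algebra.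
From mathcomp Require Import freeg mpoly ring.

Set Implicit Arguments.
Unset Strict Implicit.
Unset Printing Implicit Defensive.

Import GRing.Theory.
Local Open Scope ring_scope.

(* The free group F(n), as freely reduced words.  The letter (i, true) stands *)
(* for x_i and (i, false) for its inverse.                                    *)

Section FreeGroup.
Variable n : nat.

Definition letter : Type := 'I_n * bool.
Definition invl (a : letter) : letter := (a.1, ~~ a.2).
Definition reduced_word (w : seq letter) := sorted (fun a b => b != invl a) w.

HB.instance Definition _ := Choice.on letter.

Record free_group := FreeGroup { fgword : seq letter; _ : reduced_word fgword }.

HB.instance Definition _ := [isSub for fgword].
HB.instance Definition _ := [Choice of free_group by <:].

Definition push (a : letter) (w : seq letter) :=
  if w is b :: w' then if b == invl a then w' else a :: w else [:: a].

Lemma invlK : involutive invl.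
Proof. by case=> i b; rewrite /invl /= negbK. Qed.

Lemma invl_neq a : a != invl a.
Proof. by case: a => i [] /=; rewrite -pair_eqE /= andbF. Qed.

Lemma push_reduced a w : reduced_word w -> reduced_word (push a w).
Proof.
case: w => [//|b w] /=; case: eqP => [_|/eqP ba] /=.
  by case: w => //= c w /andP[].
by rewrite /reduced_word /= ba.
Qed.

Lemma pushK a w : reduced_word w -> push a (push (invl a) w) = w.
Proof.
case: w => [_|b w] /=; first by rewrite eqxx.
rewrite invlK; case: eqP => [->|_ _] /=; last by rewrite eqxx.
by case: w => [//|c w] /=; case/andP; case: eqP.
Qed.

Definition wmul (v w : seq letter) := foldr push w v.

Lemma wmul_reduced v w : reduced_word w -> reduced_word (wmul v w).
Proof. by move=> rw; elim: v => //= a v; apply: push_reduced. Qed.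

Lemma wmul_push a v w : reduced_word w -> wmul (push a v) w = push a (wmul v w).
Proof.
move=> rw; case: v => [//|b v] /=; case: eqP => [->|//] /=.
by rewrite pushK ?wmul_reduced.
Qed.

Lemma wmulA u v w : reduced_word w -> wmul u (wmul v w) = wmul (wmul u v) w.
Proof. by move=> rw; elim: u => //= a u ->; rewrite wmul_push. Qed.

Lemma wmulw1 w : reduced_word w -> wmul w [::] = w.
Proof.
elim: w => //= a w IHw raw; rewrite IHw; last by case: w raw {IHw} => //= b w /andP[].
by case: w raw {IHw} => //= b w /andP[/negPf->].
Qed.

Definition winv (w : seq letter) := rev (map invl w).

Lemma winv_reduced w : reduced_word w -> reduced_word (winv w).
Proof.
rewrite /reduced_word /winv rev_sorted sorted_map.
have rel : relpre invl (fun b a => b != invl a) =2 (fun a b => b != invl a).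
  by move=> a b /=; rewrite invlK eq_sym.
by rewrite (eq_sorted rel).
Qed.

Lemma wmulVw w : wmul (winv w) w = [::].
Proof.
rewrite /winv; elim: w => [//|a w IHw] /=.
by rewrite rev_cons -cats1 /wmul foldr_cat /= invlK eqxx.
Qed.

Lemma wmulwV w : wmul w (winv w) = [::].
Proof.
have winvK : winv (winv w) = w.
  by rewrite /winv map_rev revK mapK //; apply: invlK.
by rewrite -{1}winvK wmulVw.
Qed.

Lemma fgwordP (u : free_group) : reduced_word (fgword u).
Proof. exact: valP u. Qed.

Definition fg_one : free_group := @FreeGroup [::] isT.
Definition fg_mul (u v : free_group) : free_group :=
  FreeGroup (wmul_reduced (fgword u) (fgwordP v)).
Definition fg_inv (u : free_group) : free_group :=
  FreeGroup (winv_reduced (fgwordP u)).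

Lemma fg_mulA : associative fg_mul.
Proof. by move=> u v w; apply: val_inj => /=; rewrite wmulA ?fgwordP. Qed.
Lemma fg_mul1 : left_id fg_one fg_mul.
Proof. by move=> u; apply: val_inj. Qed.
Lemma fg_mulr1 : right_id fg_one fg_mul.
Proof. by move=> u; apply: val_inj; rewrite /= wmulw1 ?fgwordP. Qed.
Lemma fg_mulV : left_inverse fg_one fg_inv fg_mul.
Proof. by move=> u; apply: val_inj; rewrite /= wmulVw. Qed.
Lemma fg_mulrV : right_inverse fg_one fg_inv fg_mul.
Proof. by move=> u; apply: val_inj; rewrite /= wmulwV. Qed.

HB.instance Definition _ :=
  isGroup.Build free_group fg_mulA fg_mul1 fg_mulr1 fg_mulV fg_mulrV.

Definition fg_gen (i : 'I_n) : free_group := @FreeGroup [:: (i, true)] isT.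

Definition fg_letter (a : letter) : free_group := @FreeGroup [:: a] isT.
End FreeGroup.

HB.instance Definition _ (T : choiceType) (U : lmodType int) (f : T -> U) :=
  GRing.isZmodMorphism.Build {freeg T / int} U (fglift f) (lift_is_additive f).

Lemma fgliftU (T : choiceType) (U : lmodType int) (f : T -> U) x :
  fglift f << x >> = f x.
Proof. by rewrite liftU scale1r. Qed.

Lemma freeg_additive_ext (T : choiceType) (U : zmodType)
    (f g : {additive {freeg T / int} -> U}) :
  (forall x, f << x >> = g << x >>) -> f =1 g.
Proof.
move=> fg D; rewrite -[D]freeg_sumE !raddf_sum; apply: eq_bigr => x _.
by rewrite -[coeff x D]intz -freegU_mulz !raddfMz fg.
Qed.

(* The integral group ring Z[G], on the free abelian group on G. *)

Definition group_ring (G : groupType) : Type := {freeg G / int}.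

Section GroupRing.
Variable G : groupType.

HB.instance Definition _ := GRing.Lmodule.on (group_ring G).

Definition gr_elt (g : G) : group_ring G := << g >>.

Definition gr_translate (g : G) : group_ring G -> group_ring G :=
  fglift (fun h => gr_elt (g * h)%g).
Definition gr_mulr (b a : group_ring G) : group_ring G :=
  fglift (fun g => gr_translate g b) a.
Definition gr_mul (a b : group_ring G) : group_ring G := gr_mulr b a.

HB.instance Definition _ g := GRing.Additive.copy (gr_translate g) (fglift _).
HB.instance Definition _ b := GRing.Additive.copy (gr_mulr b) (fglift _).

Lemma gr_mul_eltl g b : gr_mul (gr_elt g) b = gr_translate g b.
Proof. exact: fgliftU. Qed.

Lemma gr_translate_elt g h : gr_translate g (gr_elt h) = gr_elt (g * h)%g.
Proof. exact: fgliftU. Qed.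

Lemma gr_mul_is_additive a : additive (gr_mul a).
Proof.
move=> b c; apply: (@freeg_additive_ext _ _ (gr_mulr (b - c))
                      (gr_mulr b \- gr_mulr c)) => x /=.
by rewrite -[LHS]/(gr_mul _ _) -[RHS]/(gr_mul _ _ - gr_mul _ _) !gr_mul_eltl raddfB.
Qed.

HB.instance Definition _ a :=
  GRing.isZmodMorphism.Build _ _ (gr_mul a) (gr_mul_is_additive a).

Lemma gr_translateM g h a :
  gr_translate g (gr_translate h a) = gr_translate (g * h)%g a.
Proof.
apply: (@freeg_additive_ext _ _ (gr_translate g \o gr_translate h)
          (gr_translate (g * h)%g)) => x /=.
by rewrite !gr_translate_elt mulgA.
Qed.

Lemma gr_mulA : associative gr_mul.
Proof.
move=> a b c; apply: (@freeg_additive_ext _ _ (gr_mulr (gr_mul b c))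
          (gr_mulr c \o gr_mulr b)) => x /=.
rewrite -[LHS]/(gr_mul _ _) -[RHS]/(gr_mul (gr_mul _ _) _) !gr_mul_eltl.
apply: (@freeg_additive_ext _ _ (gr_translate x \o gr_mulr c)
          (gr_mulr c \o gr_translate x)) => y /=.
rewrite gr_translate_elt.
by rewrite -[in LHS]/(gr_mul _ _) -[RHS]/(gr_mul _ _) !gr_mul_eltl gr_translateM.
Qed.

Lemma gr_mul1 : left_id (gr_elt 1%g) gr_mul.
Proof.
move=> a; rewrite gr_mul_eltl.
apply: (@freeg_additive_ext _ _ (gr_translate 1%g) idfun) => x /=.
by rewrite gr_translate_elt mul1g.
Qed.

Lemma gr_mulr1 : right_id (gr_elt 1%g) gr_mul.
Proof.
move=> a; apply: (@freeg_additive_ext _ _ (gr_mulr (gr_elt 1%g)) idfun) => x /=.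
by rewrite -[LHS]/(gr_mul _ _) gr_mul_eltl gr_translate_elt mulg1.
Qed.

Lemma gr_mulDl : left_distributive gr_mul +%R.
Proof. by move=> a b c; rewrite /gr_mul raddfD. Qed.
Lemma gr_mulDr : right_distributive gr_mul +%R.
Proof. by move=> a b c; rewrite raddfD. Qed.

Lemma gr_elt1_neq0 : gr_elt 1%g != 0.
Proof. by rewrite freegU_eq0. Qed.

HB.instance Definition _ := GRing.Zmodule_isNzRing.Build (group_ring G)
  gr_mulA gr_mul1 gr_mulr1 gr_mulDl gr_mulDr gr_elt1_neq0.

Lemma gr_eltM g h : gr_elt (g * h)%g = gr_elt g * gr_elt h.
Proof. by rewrite [RHS]gr_mul_eltl gr_translate_elt. Qed.

Definition augm (a : group_ring G) : int := deg a.

HB.instance Definition _ := GRing.Additive.copy augm (@deg G).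

Lemma augm_elt g : augm (gr_elt g) = 1.
Proof. exact: degU. Qed.

End GroupRing.

Section Fox.
Variable n : nat.
Implicit Types (i j : 'I_n) (w : seq (letter n)).

Local Notation ZF := (group_ring (free_group n)).

Definition fox_letter i (a : letter n) : ZF :=
  if a.1 == i then (if a.2 then 1 else - gr_elt (fg_letter a)) else 0.

Fixpoint fox_word i w : ZF :=
  if w is a :: w' then fox_letter i a + gr_elt (fg_letter a) * fox_word i w'
  else 0.

(* The Fox derivative with respect to x_i; see fox_gen and foxM. *)
Definition fox i : ZF -> ZF := fglift (fun u => fox_word i (fgword u)).

HB.instance Definition _ i := GRing.Additive.copy (fox i) (fglift _).

Lemma fox_elt i u : fox i (gr_elt u) = fox_word i (fgword u).
Proof. exact: fgliftU. Qed.

Lemma fox1 i : fox i 1 = 0.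
Proof. exact: fox_elt. Qed.

Lemma fox_gen i j : fox i (gr_elt (fg_gen j)) = (i == j)%:R.
Proof.
by rewrite fox_elt /= mulr0 addr0 /fox_letter /= eq_sym; case: (i == j).
Qed.

Lemma fg_letterV a : (fg_letter (invl a) * fg_letter a)%g = 1%g :> free_group n.
Proof. by apply: val_inj; rewrite /= invlK eqxx. Qed.

Lemma fg_letterVr a : (fg_letter a * fg_letter (invl a))%g = 1%g :> free_group n.
Proof. by apply: val_inj; rewrite /= eqxx. Qed.

Lemma fox_letterV i a :
  fox_letter i a + gr_elt (fg_letter a) * fox_letter i (invl a) = 0.
Proof.
rewrite /fox_letter /=; case: eqP => _; last by rewrite mulr0 addr0.
case: a => j [] /=; last by rewrite mulr1 addNr.
by rewrite mulrN -gr_eltM [(_ * _)%g](fg_letterVr (j, true)) subrr.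
Qed.

Lemma fox_push i a w :
  fox_word i (push a w) = fox_letter i a + gr_elt (fg_letter a) * fox_word i w.
Proof.
case: w => [//|b w] /=; case: eqP => [->|//].
rewrite mulrDr addrA fox_letterV add0r mulrA -gr_eltM fg_letterVr.
by rewrite mul1r.
Qed.

Lemma fg_cons a w (raw : reduced_word (a :: w)) (rw : reduced_word w) :
  FreeGroup raw = (fg_letter a * FreeGroup rw)%g.
Proof.
apply: val_inj; rewrite /=; case: w raw {rw} => //= b w /andP[/negPf->] //.
Qed.

Lemma fox_eltM i (u v : free_group n) :
  fox i (gr_elt (u * v)%g) = fox i (gr_elt u) + gr_elt u * fox i (gr_elt v).
Proof.
rewrite !fox_elt /=; case: u => w rw /=.
elim: w rw => [|a w IHw] raw /=.
  by rewrite add0r (_ : FreeGroup raw = 1%g) ?mul1r //; apply: val_inj.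
have rw : reduced_word w by case: w raw {IHw} => //= b w /andP[].
by rewrite fox_push (IHw rw) mulrDr addrA mulrA -gr_eltM -fg_cons.
Qed.

Lemma foxM i (a b : ZF) : fox i (a * b) = fox i a * (augm b)%:~R + a * fox i b.
Proof.
have ext_a (c d : ZF) : (forall g, fox i (gr_elt g * b) =
    fox i (gr_elt g) * c + gr_elt g * d) ->
    fox i (a * b) = fox i a * c + a * d.
  move=> E; apply: (@freeg_additive_ext _ _ (fox i \o gr_mulr b)
    ((gr_mulr c \o fox i) \+ gr_mulr d)) => g; exact: E.
apply: ext_a => g.
apply: (@freeg_additive_ext _ _ (fox i \o gr_mul (gr_elt g))
  ((gr_mul (fox i (gr_elt g)) \o intmul 1 \o @augm _) \+
    (gr_mul (gr_elt g) \o fox i))) => h /=.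
rewrite -[LHS]/(fox i (gr_elt g * gr_elt h)) -gr_eltM fox_eltM.
by rewrite -/(gr_elt h) augm_elt; rewrite -[gr_mul _ _]/(fox i (gr_elt g) * 1) mulr1.
Qed.
End Fox.

(* Z[t_1^+-1, ..., t_n^+-1] as a free abelian group: the basis element << a >> *)
(* is the monomial t^a = \prod_i t_i ^ (a_i), for a in Z^n.                    *)
Definition laurent (n : nat) : Type := {freeg 'rV[int]_n / int}.

HB.instance Definition _ n := GRing.Lmodule.on (laurent n).

Section Alexander.
Variable n : nat.

Definition letter_exp (a : letter n) : 'rV[int]_n :=
  (if a.2 then 1 else - 1) *: delta_mx 0 a.1.

(* The class of u in F(n)/[F(n), F(n)] = Z^n.                                  *)
Definition abelianize (u : free_group n) : 'rV[int]_n :=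
  \sum_(a <- fgword u) letter_exp a.

(* The map induced by x_i |-> t_i. *)
Definition alpha : group_ring (free_group n) -> laurent n :=
  fglift (fun u => << abelianize u >> : laurent n).

(* (1 + s_i) ^ z, where the series (1 + s_i)^-1 = \sum_q (-1)^q s_i^q is      *)
(* truncated after the terms of degree d.                                     *)
Definition one_plus_exp (d : nat) (i : 'I_n) (z : int) : {mpoly int[n]} :=
  match z with
  | Posz k => (1 + 'X_i) ^+ k
  | Negz k => (\sum_(q < d.+1) (-1) ^+ q *: 'X_i ^+ q) ^+ k.+1
  end.

(* The homogeneous part of degree d of the power series obtained from a       *)
(* Laurent polynomial by t_i = 1 + s_i, with 'X_i standing for s_i: the terms *)
(* dropped by one_plus_exp d only contribute in degrees > d.                  *)
Definition homogeneous_part (d : nat) : laurent n -> {mpoly int[n]} :=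
  fglift (fun a : 'rV[int]_n =>
    pihomog mdeg d (\prod_(i < n) one_plus_exp d i (a 0 i))).

HB.instance Definition _ := GRing.Additive.copy alpha (fglift _).
HB.instance Definition _ d := GRing.Additive.copy (homogeneous_part d) (fglift _).

Lemma augm_fox_letter i (a : letter n) :
  augm (fox_letter i a) = letter_exp a 0 i.
Proof.
rewrite /fox_letter /letter_exp !mxE eqxx /= [i == _]eq_sym.
case: eqP => _; last by rewrite mulr0 raddf0.
by case: a.2; rewrite ?raddfN /= augm_elt ?mulr1.
Qed.

Lemma augm_translate g (a : group_ring (free_group n)) :
  augm (gr_elt g * a) = augm a.
Proof.
rewrite [gr_elt g * a]gr_mul_eltl.
apply: (@freeg_additive_ext _ _ (@augm _ \o gr_translate g) (@augm _)) => h /=.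
by rewrite gr_translate_elt !augm_elt.
Qed.

Lemma augm_fox i (u : free_group n) :
  augm (fox i (gr_elt u)) = abelianize u 0 i.
Proof.
rewrite fox_elt /abelianize summxE; elim: (fgword u) => [|a w IHw] /=.
  by rewrite big_nil raddf0.
by rewrite big_cons raddfD /= augm_fox_letter augm_translate IHw.
Qed.

Lemma abelianize_gen i : abelianize (fg_gen i) = delta_mx 0 i.
Proof. by rewrite /abelianize big_seq1 /letter_exp scale1r. Qed.

Lemma abelianizeM (u v : free_group n) :
  abelianize (u * v)%g = abelianize u + abelianize v.
Proof.
apply/rowP => i; rewrite !mxE -!augm_fox fox_eltM raddfD /=.
by rewrite augm_translate.
Qed.

Lemma pihomog1E (p : {mpoly int[n]}) :
  pihomog mdeg 1 p = \sum_i p@_U_(i) *: 'X_i.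
Proof.
apply/mpolyP => l; rewrite pihomogE !raddf_sum /=.
under eq_bigr do rewrite mcoeffZ mcoeffX.
under [in RHS]eq_bigr do rewrite mcoeffZ mcoeffX.
have [/mdeg1P[j /eqP->]|ndeg] := boolP (mdeg l == 1%N).
  rewrite [RHS](bigD1 j) //= eqxx mulr1 [X in _ + X]big1 ?addr0; last first.
    move=> k /negPf kj; case: eqP => [/mnmP /(_ k)|]; last by rewrite mulr0.
    by rewrite !mnm1E eqxx eq_sym kj.
  have [jp|/memN_msupp_eq0 jp] := boolP (U_(j)%MM \in msupp p).
    rewrite big_mkcond (bigD1_seq U_(j)%MM) ?msupp_uniq //= mdeg1 !eqxx mulr1.
    by rewrite big1 ?addr0 // => k /negPf->; rewrite mulr0 if_same.
  by rewrite jp big1 // => k _; case: eqP => [->|]; rewrite ?jp ?mul0r ?mulr0.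
rewrite !big1 // => k => [_|degk].
  by case: eqP => [E|]; rewrite ?mulr0 //; case/negP: ndeg; rewrite -E mdeg1.
by case: eqP => [E|]; rewrite ?mulr0 //; case/negP: ndeg; rewrite -E.
Qed.

Lemma mcoeffU_M j (p q : {mpoly int[n]}) :
  (p * q)@_U_(j) = p@_U_(j) * q@_0 + p@_0 * q@_U_(j).
Proof.
have E (f : {mpoly int[n]}) : f@_U_(j) = (mderiv j f)@_0.
  by rewrite mcoeff_deriv mnm0E add0m.
by rewrite !E mderivM mcoeffD !rmorphM.
Qed.

Lemma mcoeffU_X j (p : {mpoly int[n]}) k :
  p@_0 = 1 -> (p ^+ k)@_U_(j) = p@_U_(j) * k%:Z.
Proof.
move=> p1; elim: k => [|k IHk].
  by rewrite expr0 mulr0 mcoeff1 -mdeg_eq0 mdeg1.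
by rewrite exprS mcoeffU_M IHk rmorphXn /= p1 expr1n mulr1 mul1r -addn1 addnC
  PoszD mulrDr mulr1.
Qed.

Lemma one_plus_exp0 i z : (one_plus_exp 1 i z)@_0 = 1.
Proof.
have X0 : 'X_i@_0 = 0 :> int by rewrite mcoeffX -mdeg_eq0 mdeg1.
case: z => k; rewrite rmorphXn /=; last rewrite !big_ord_recl big_ord0.
  by rewrite rmorphD rmorph1 /= X0 addr0 expr1n.
by rewrite !expr0 expr1 scale1r addr0 mcoeffD mcoeffZ X0 mulr0 addr0 mcoeff1 eqxx expr1n.
Qed.

Lemma one_plus_expU i j z : (one_plus_exp 1 i z)@_U_(j) = (i == j)%:R * z.
Proof.
have XU : 'X_i@_U_(j) = (i == j)%:R :> int.
  rewrite mcoeffX; congr (_ : bool)%:R; apply/eqP/eqP => [|-> //].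
  by move/mnmP/(_ i); rewrite !mnm1E eqxx; case: eqP.
have one : (1 : {mpoly int[n]})@_U_(j) = 0 by rewrite mcoeff1 -mdeg_eq0 mdeg1.
have := one_plus_exp0 i 1; rewrite /= expr1 => c1.
have := one_plus_exp0 i (Negz 0); rewrite /= expr1 => cN.
case: z => k /=; rewrite mcoeffU_X //.
  by rewrite mcoeffD one add0r XU.
rewrite !big_ord_recl big_ord0 /= !expr0 expr1 scale1r addr0 mcoeffD mcoeffZ.
by rewrite one add0r XU NegzE mulN1r mulNr mulrN.
Qed.

Lemma homogeneous_part1_elt (a : 'rV[int]_n) :
  homogeneous_part 1 << a >> = \sum_i a 0 i *: 'X_i.
Proof.
rewrite [LHS]fgliftU pihomog1E; apply: eq_bigr => j _; congr (_ *: _).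
pose P (p : {mpoly int[n]}) (c : int) := p@_0 = 1 /\ p@_U_(j) = c.
have [_ ->] : P (\prod_(i < n) one_plus_exp 1 i (a 0 i))
                (\sum_(i < n) (i == j)%:R * a 0 i).
  apply: (big_rec2 P); first by split; rewrite mcoeff1 ?eqxx // -mdeg_eq0 mdeg1.
  move=> i p c _ [p0 pU]; rewrite /P rmorphM /= mcoeffU_M.
  by rewrite one_plus_exp0 one_plus_expU p0 pU !mulr1 mul1r.
by rewrite (bigD1 j) //= eqxx mul1r big1 ?addr0 // => i /negPf->; rewrite mul0r.
Qed.

Lemma homogeneous_part1_alpha (b : group_ring (free_group n)) :
  homogeneous_part 1 (alpha b) = \sum_i augm (fox i b) *: 'X_i.
Proof.
rewrite -[b]freeg_sumE !raddf_sum /=.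
under [RHS]eq_bigr do rewrite !raddf_sum scaler_suml.
rewrite exchange_big /=; apply: eq_bigr => u _.
rewrite -[coeff u b]intz -freegU_mulz !raddfMz /= [alpha _]fgliftU.
rewrite homogeneous_part1_elt mulrz_suml; apply: eq_bigr => i _.
by rewrite !raddfMz /= augm_fox -scalerMzl.
Qed.

Variables (m : nat) (r : 'I_m -> free_group n).

Definition alexander_mx : 'M[laurent n]_(m, n) :=
  \matrix_(k, i) alpha (fox i (gr_elt (r k))).

Definition linearized_alexander_mx : 'M[{mpoly int[n]}]_(m, n) :=
  map_mx (homogeneous_part 1) alexander_mx.

Definition linearized_alexander_at (K : fieldType) (lam : 'rV[K]_n) : 'M[K]_(m, n) :=
  map_mx (mmap (intr : int -> K) (lam 0)) linearized_alexander_mx.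


Lemma linearized_alexander_mxE k j :
  linearized_alexander_mx k j =
  \sum_i augm (fox i (fox j (gr_elt (r k)))) *: 'X_i.
Proof. by rewrite !mxE homogeneous_part1_alpha. Qed.

End Alexander.

Section Presentations.

Inductive generated (H : groupType) (S : H -> Prop) : H -> Prop :=
  | generated1 : generated S 1%g
  | generated_gen g : S g -> generated S g
  | generatedM g h : generated S g -> generated S h -> generated S (g * h)%g
  | generatedV g : generated S g -> generated S (g^-1)%g.

Definition derived_subgroup (H : groupType) : H -> Prop :=
  generated (fun g => exists h k : H, g = [~ h, k]%g).

Definition normal_closure (H : groupType) (S : H -> Prop) : H -> Prop :=
  generated (fun g => exists s h : H, S s /\ g = (s ^ h)%g).

Variables (n : nat) (G : groupType) (x : 'I_n -> G).

(* The morphism F(n) -> G that sends the generators to x_1, ..., x_n. *)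
Definition fg_eval (u : free_group n) : G :=
  (\prod_(a <- fgword u) if a.2 then x a.1 else (x a.1)^-1)%g.

Lemma fg_eval_gen i : fg_eval (fg_gen i) = x i.
Proof. by rewrite /fg_eval big_seq1. Qed.

Lemma fg_evalM u v : fg_eval (u * v)%g = (fg_eval u * fg_eval v)%g.
Proof.
rewrite /fg_eval /=; elim: (fgword u) => [|a w IHw] /=.
  by rewrite big_nil mul1g.
rewrite big_cons -mulgA -IHw; case: (wmul _ _) => [|b w'] /=.
  by rewrite big_seq1 big_nil mulg1.
case: eqP => [->|_]; rewrite !big_cons //= mulgA.
by case: a.2; rewrite /= ?mulgV ?mulVg mul1g.
Qed.

(* G = < x_1, ..., x_n | r_1, ..., r_m >. *)
Definition presented_by (m : nat) (r : 'I_m -> free_group n) : Prop :=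
  (forall g, exists u, fg_eval u = g) /\
  (forall u, fg_eval u = 1%g <-> normal_closure (fun s => exists k, s = r k) u).

End Presentations.

(* The homology of G with coefficients Z and its cohomology with trivial       *)
(* coefficients K, that is, those of K(G, 1), by the (inhomogeneous) bar       *)
(* complex.                                                                    *)

Section Homology.
Variable G : groupType.

Definition bar_d2 : {freeg (G * G) / int} -> {freeg G / int} :=
  fglift (fun p => let: (g, h) := p in << h >> - << (g * h)%g >> + << g >>).

Definition bar_d3 : {freeg (G * G * G) / int} -> {freeg (G * G) / int} :=
  fglift (fun p => let: (g, h, k) := p in
    << (h, k) >> - << ((g * h)%g, k) >> + << (g, (h * k)%g) >> - << (g, h) >>).

HB.instance Definition _ := GRing.Additive.copy bar_d2 (fglift _).
HB.instance Definition _ := GRing.Additive.copy bar_d3 (fglift _).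

Lemma bar_d2d3 c : bar_d2 (bar_d3 c) = 0.
Proof.
apply: (@freeg_additive_ext _ _ (bar_d2 \o bar_d3) \0) => -[[g h] k] /=.
rewrite [bar_d3 _]fgliftU raddfB raddfD raddfB /=.
rewrite ![bar_d2 << _ >>]fgliftU mulgA; apply/eqP/freeg_eqP => y.
rewrite !(coeffB, coeffD) coeff0; ring.
Qed.

(* For all z in Z_2 and q > 0, if q z is in B_2 then so is z.                  *)
Definition H2_torsion_free : Prop :=
  forall z, bar_d2 z = 0 ->
  forall q : nat, (0 < q)%N -> (exists c, bar_d3 c = z *+ q) ->
  exists c, bar_d3 c = z.

End Homology.

Section Resonance.
Variables (G : groupType) (K : fieldType).

Definition bar_delta1 (u : G -> K) (g h : G) : K := u h - u (g * h)%g + u g.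

(* H^1(G, K): the 1-cocycles, since the 1-coboundaries vanish for trivial      *)
(* coefficients.                                                               *)
Definition H1 (u : G -> K) : Prop := forall g h, bar_delta1 u g h = 0.

Definition cup (u v : G -> K) (g h : G) : K := u g * v h.

Definition H2_zero (c : G -> G -> K) : Prop :=
  exists b : G -> K, forall g h, c g h = bar_delta1 b g h.

Definition subspace_of_dim (W : (G -> K) -> Prop) (k : nat) : Prop :=
  exists b : 'I_k -> G -> K,
    (forall a : 'I_k -> K, (forall g, \sum_i a i * b i g = 0) -> forall i, a i = 0)
    /\ (forall w, W w <-> exists a : 'I_k -> K, forall g, w g = \sum_i a i * b i g).

Definition resonance (d : nat) (u : G -> K) : Prop :=
  H1 u /\
  exists W : (G -> K) -> Prop,
    [/\ forall w, W w -> H1 w,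
        subspace_of_dim W d.+1
      & forall w, W w -> H2_zero (cup u w)].

(* The coordinates in the basis e_1, ..., e_n dual to the classes of the x_i.  *)
Definition H1_coord (n : nat) (x : 'I_n -> G) (u : G -> K) : 'rV[K]_n :=
  \row_i u (x i).

End Resonance.

(* Main.v *)
Require Import Defs.
From mathcomp Require Import all_boot all_order all_algebra.
From mathcomp Require Import mpoly ring.

(** For homomorphisms f_lam, f_w : F(n) -> K with coordinates lam and w, the
    function B(u) = \sum_(i, j) lam_i w_j eps(d_i d_j u) satisfies
    B(uv) = B(u) + B(v) + f_lam(u) f_w(v), so -B cobounds f_lam cup f_w on F(n).
    Any other primitive differs from -B by a homomorphism, which kills the
    relators because they lie in the derived subgroup; and B is additive and
    conjugation invariant on the normal closure of the relators.  Hence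
    f_lam cup f_w vanishes in H^2(G, K) iff B vanishes on the relators, that is
    iff M(lam) w = 0, and the theorem is rank-nullity for M(lam). *)

Set Implicit Arguments.
Unset Strict Implicit.
Unset Printing Implicit Defensive.

Import GRing.Theory.
Local Open Scope ring_scope.

(** * Additive maps from a group to an abelian group *)

Section AdditiveFunctions.
Variables (H : groupType) (V : zmodType) (f : H -> V).
Hypothesis fM : forall g h, f (g * h)%g = f g + f h.

Lemma add_fun1 : f 1%g = 0.
Proof. by apply: (addrI (f 1%g)); rewrite -fM mulg1 addr0. Qed.

Lemma add_funV g : f (g^-1)%g = - f g.
Proof. by apply/eqP; rewrite -addr_eq0 -fM mulVg add_fun1. Qed.

Lemma add_fun_generated (S : H -> Prop) :
  (forall g, S g -> f g = 0) -> forall g, generated S g -> f g = 0.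
Proof.
move=> fS g; elim=> {g} [|g /fS //|g h _ fg _ fh|g _ fg]; first exact: add_fun1.
- by rewrite fM fg fh addr0.
- by rewrite add_funV fg oppr0.
Qed.

Lemma add_fun_conj g h : f (g ^ h)%g = f g.
Proof. by rewrite /conjg !fM add_funV addrC addrK. Qed.

(** [[~ h, k]] is [h^-1 * h ^ k], and [f] does not see the conjugation. *)
Lemma add_fun_derived g : derived_subgroup g -> f g = 0.
Proof.
apply: add_fun_generated => _ [h [k ->]].
by rewrite /commg fM add_fun_conj add_funV addNr.
Qed.

End AdditiveFunctions.

(** * Homomorphisms and second-order Fox coefficients on F(n) *)

Section FreeGroupFunctions.
Variables (K : fieldType) (n : nat).
Implicit Types (lam w : 'rV[K]_n) (u v : free_group n).

Definition lin_fun lam u : K := \sum_i lam 0 i * (abelianize u 0 i)%:~R.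

Lemma lin_funM lam u v : lin_fun lam (u * v)%g = lin_fun lam u + lin_fun lam v.
Proof.
rewrite -big_split; apply: eq_bigr => i _ /=.
by rewrite abelianizeM mxE rmorphD mulrDr.
Qed.

Lemma lin_fun_gen lam i : lin_fun lam (fg_gen i) = lam 0 i.
Proof.
rewrite /lin_fun abelianize_gen (bigD1 i) //= mxE !eqxx mulr1 big1 ?addr0 //.
by move=> j /negPf ji; rewrite mxE ji andbF mulr0.
Qed.

(** In d_i d_j (uv), the product rule applied to u d_j v gives the cross term eps(d_i u) eps(d_j v),
    a product of exponent sums. *)
Lemma augm_fox2M i j u v :
  augm (fox i (fox j (gr_elt (u * v)%g))) =
  augm (fox i (fox j (gr_elt u))) + augm (fox i (fox j (gr_elt v))) +
  abelianize u 0 i * abelianize v 0 j.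
Proof.
rewrite fox_eltM !raddfD /= foxM raddfD /= augm_translate mulrzr raddfMz /=.
by rewrite !augm_fox -mulrzr intz addrA addrAC.
Qed.

(** The function B of the introduction; [lin_fun lam] is f_lam. *)
Definition fox2_form lam w u : K :=
  \sum_i \sum_j lam 0 i * w 0 j * (augm (fox i (fox j (gr_elt u))))%:~R.

Lemma fox2_formM lam w u v :
  fox2_form lam w (u * v)%g =
  fox2_form lam w u + fox2_form lam w v + lin_fun lam u * lin_fun w v.
Proof.
rewrite /fox2_form /lin_fun big_distrlr -!big_split /=; apply: eq_bigr => i _.
rewrite -!big_split /=; apply: eq_bigr => j _.
by rewrite augm_fox2M; ring.
Qed.

Lemma fox2_form1 lam w : fox2_form lam w 1%g = 0.
Proof.
have := fox2_formM lam w 1%g 1%g.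
rewrite mulg1 (add_fun1 (lin_funM lam)) mul0r addr0 => /eqP.
by rewrite -subr_eq subrr eq_sym => /eqP.
Qed.

(** Vectors are rows, so M(lam) w takes the form [w *m M^T]; the column index of M pairs with w and
    its variables s_i are evaluated at lam. *)
Lemma fox2_form_relator m (r : 'I_m -> free_group n) lam w k :
  fox2_form lam w (r k) = (w *m (linearized_alexander_at r lam)^T) 0 k.
Proof.
rewrite /fox2_form exchange_big mxE; apply: eq_bigr => j _ /=.
rewrite [_^T _ _]mxE [linearized_alexander_at _ _ _ _]mxE.
rewrite linearized_alexander_mxE raddf_sum mulr_sumr; apply: eq_bigr => i _ /=.
by rewrite mmapZ mmapX mmap1U; ring.
Qed.

End FreeGroupFunctions.

(** * Descent from F(n) to G: first cohomology and cup products *)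

Section Presented.
Variables (K : fieldType) (n m : nat) (G : groupType).
Variables (x : 'I_n -> G) (r : 'I_m -> free_group n).
Hypothesis presG : presented_by x r.
Hypothesis comm_rel : forall k, derived_subgroup (r k).
Implicit Types (lam w : 'rV[K]_n) (u v : free_group n) (f : G -> K).

Lemma fg_eval1 : fg_eval x 1%g = 1%g.
Proof. by rewrite /fg_eval big_nil. Qed.

Lemma fg_evalV u : fg_eval x (u^-1)%g = ((fg_eval x u)^-1)%g.
Proof. by apply: (mulgI (fg_eval x u)); rewrite -fg_evalM !mulgV fg_eval1. Qed.

(** Homomorphisms to K kill conjugates of relators, hence the whole kernel; so each of them factors
    through G. *)
Lemma lin_fun_ker lam v : fg_eval x v = 1%g -> lin_fun lam v = 0.
Proof.
move/presG.2; apply: add_fun_generated => [|_ [_ [h [[k ->] ->]]]].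
  exact: lin_funM.
rewrite (add_fun_conj (lin_funM lam)).
exact: add_fun_derived (lin_funM lam) _ (comm_rel k).
Qed.

Lemma fox2_form_ker lam w :
  (forall k, fox2_form lam w (r k) = 0) ->
  forall v, fg_eval x v = 1%g -> fox2_form lam w v = 0.
Proof.
move=> Br v /presG.2.
(* On the kernel both factors of the cross term vanish, so B is additive there. *)
have ker u : normal_closure (fun s => exists k, s = r k) u ->
  (lin_fun lam u = 0) * (lin_fun w u = 0).
  by move=> /presG.2 u1; split; apply: lin_fun_ker.
elim=> {v} [|_ [_ [h [[k ->] ->]]]|u v /ker Nu Bu _ Bv|u /ker Nu Bu].
- exact: fox2_form1.
- have rk c : lin_fun c (r k) = 0 :> K.
    exact: add_fun_derived (lin_funM c) _ (comm_rel k).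
  rewrite /conjg !fox2_formM !lin_funM Br !rk.
  (* B(h^-1 r_k h) has reduced to B(h^-1) + B(h) + f_lam(h^-1) f_w(h), which is B(h^-1 h) = 0. *)
  have := fox2_formM lam w (h^-1)%g h; rewrite mulVg fox2_form1 => E.
  by rewrite mul0r addr0 !add0r -E.
- by rewrite fox2_formM Bu Bv Nu mul0r !addr0.
have := fox2_formM lam w u (u^-1)%g.
by rewrite mulgV fox2_form1 Bu Nu mul0r addr0 add0r.
Qed.

(** A 1-cocycle with trivial coefficients is a homomorphism, determined by its values on
    generators. *)
Lemma H1_fg_eval f v : H1 f -> f (fg_eval x v) = lin_fun (H1_coord x f) v.
Proof.
move=> /(_ _ _)/eqP f0.
have fM g h : f (g * h)%g = f g + f h.
  by have := f0 g h; rewrite /bar_delta1 addrAC subr_eq0 addrC => /eqP.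
have: forall i, H1_coord x f 0 i = f (x i) by move=> i; rewrite mxE.
rewrite /lin_fun /abelianize /fg_eval; move: (H1_coord x f) => c cE.
elim: (fgword v) => [|a s IHs].
  by rewrite !big_nil (add_fun1 fM) big1 // => i _; rewrite mxE mulr0.
rewrite !big_cons fM IHs; under [RHS]eq_bigr do rewrite mxE rmorphD mulrDr /=.
rewrite big_split /=; congr (_ + _); rewrite /letter_exp.
rewrite (bigD1 a.1) //= big1 => [|i /negPf ia]; rewrite !mxE; last first.
  by rewrite ia andbF !mulr0.
rewrite !eqxx addr0 mulr1 cE; case: a.2; first by rewrite mulr1.
by rewrite (add_funV fM) mulrN1.
Qed.

(** Two words over one element of G differ by a left factor in the kernel, so any choice of preimage
    gives the same value. *)
Lemma descend (f : free_group n -> K) :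
  (forall v u, fg_eval x v = 1%g -> f (v * u)%g = f u) ->
  exists f', forall u, f' (fg_eval x u) = f u.
Proof.
move=> fN; have surj g : exists u, fg_eval x u == g.
  by have [u <-] := presG.1 g; exists u.
exists (fun g => f (xchoose (surj g))) => u.
have /eqP := xchooseP (surj (fg_eval x u)); move: (xchoose _) => v uv.
rewrite -[v](mulgVK u) -mulgA; set t := (_^-1 * u)%g.
by rewrite mulgA fN // fg_evalM fg_evalV uv mulgV.
Qed.

(** With [H1_coord_eq0], this identifies H^1(G, K) with K^n. *)
Lemma H1_extend lam : exists f, H1 f /\ H1_coord x f = lam.
Proof.
have [v u v1|f fE] := descend (f := lin_fun lam).
  by rewrite lin_funM lin_fun_ker ?add0r.
exists f; split=> [g h|].
  have [[u <-] [v <-]] := (presG.1 g, presG.1 h).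
  by rewrite /bar_delta1 -fg_evalM !fE lin_funM; ring.
by apply/rowP => i; rewrite mxE -(fg_eval_gen x) fE lin_fun_gen.
Qed.

Lemma H2_zero_cup f g : H1 f -> H1 g ->
  H2_zero (cup f g) <->
  H1_coord x g *m (linearized_alexander_at r (H1_coord x f))^T = 0.
Proof.
move=> f1 g1; set lam := H1_coord x f; set w := H1_coord x g.
have B0 : w *m (linearized_alexander_at r lam)^T = 0 <->
    forall k, fox2_form lam w (r k) = 0.
  split=> [E k|E]; first by rewrite fox2_form_relator E mxE.
  by apply/rowP => k; rewrite -fox2_form_relator E mxE.
rewrite B0; split=> [[b bE] k|/fox2_form_ker Bker].
  have rk1 : fg_eval x (r k) = 1%g.
    apply/presG.2/generated_gen; exists (r k), 1%g.
    by rewrite conjg1; split=> //; exists k.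
  pose F u := b (fg_eval x u) + fox2_form lam w u.
  have FM u v : F (u * v)%g = F u + F v.
    have := bE (fg_eval x u) (fg_eval x v).
    rewrite /cup /bar_delta1 (H1_fg_eval _ f1) (H1_fg_eval _ g1) -fg_evalM.
    rewrite /F fox2_formM -/lam -/w.
    by move=> ->; ring.
  (* Both sides are 0; as r_k maps to 1 in G, the values of [b] cancel and B(r_k) = B(1) remains. *)
  have : F (r k) = F 1%g.
    by rewrite (add_fun1 FM) (add_fun_derived FM (comm_rel k)).
  by rewrite /F rk1 fg_eval1 fox2_form1 => /addrI.
have [v u v1|b bE] := descend (f := fun u => - fox2_form lam w u).
  by rewrite fox2_formM Bker // lin_fun_ker // mul0r addr0 add0r.
exists b => g' h'; have [[u <-] [v <-]] := (presG.1 g', presG.1 h').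
rewrite /bar_delta1 -fg_evalM !bE fox2_formM /cup.
by rewrite (H1_fg_eval _ f1) (H1_fg_eval _ g1) -/lam -/w; ring.
Qed.

Lemma H1_sum k (a : 'I_k -> K) (b : 'I_k -> G -> K) :
  (forall i, H1 (b i)) -> H1 (fun g => \sum_i a i * b i g).
Proof.
move=> b1 g h; rewrite /bar_delta1 -sumrB -big_split big1 // => i _ /=.
by rewrite -mulrBr -mulrDr [X in _ * X]b1 mulr0.
Qed.

(** Translates independence of cocycles into row-freeness of their coordinate matrix. *)
Lemma H1_coord_sum k (a : 'I_k -> K) (b : 'I_k -> G -> K) :
  H1_coord x (fun g => \sum_i a i * b i g) =
  (\row_i a i) *m (\matrix_i H1_coord x (b i)).
Proof.
by apply/rowP => j; rewrite !mxE; apply: eq_bigr => i _; rewrite !mxE.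
Qed.

Lemma H1_coord_eq0 f : H1 f -> H1_coord x f = 0 -> forall g, f g = 0.
Proof.
move=> f1 f0 g; have [u <-] := presG.1 g; rewrite H1_fg_eval // f0.
by rewrite /lin_fun big1 // => i _; rewrite mxE mul0r.
Qed.

End Presented.

Theorem theorem3p9 (K : fieldType) (n m : nat) (G : groupType)
    (x : 'I_n -> G) (r : 'I_m -> free_group n)
    (presG : presented_by x r)
    (comm_rel : forall k, derived_subgroup (r k))
    (H2_tf : H2_torsion_free G)
    (d : nat) (le_dn : (d <= n)%N) (lam : 'rV[K]_n) :
  (exists u : G -> K, resonance d u /\ H1_coord x u = lam) <->
  (\rank (linearized_alexander_at r lam) < n - d)%N.
Proof.
(* The rank condition becomes [d.+1 + \rank A <= n]. *)
rewrite -mxrank_tr ltn_subRL -addSn; set A := (_^T)%R.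
split=> [[u [[u1 [W [W1 [b [bfree bW]] Wcup]]] ulam]]|rkA].
  have Wb i : W (b i).
    apply/bW; exists (fun j => (j == i)%:R) => g.
    rewrite (bigD1 i) //= eqxx mul1r big1 ?addr0 // => j /negPf->.
    by rewrite mul0r.
  pose P := \matrix_i H1_coord x (b i).
  have Pfree : row_free P.
    apply: inj_row_free => a aP; apply/rowP => i; rewrite mxE.
    have b1 j : H1 (b j) by apply: W1.
    apply: (bfree (a 0)); apply: (H1_coord_eq0 presG (H1_sum _ b1)).
    by rewrite H1_coord_sum -aP; congr (_ *m _); apply/rowP => j; rewrite mxE.
  have PA : P *m A = 0.
    apply/row_matrixP => i; rewrite row_mul rowK row0 /A -ulam.
    by apply/(H2_zero_cup presG comm_rel u1 (W1 _ (Wb i)))/Wcup.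
  (* The d+1 independent rows of [P] lie in the left kernel of [A], so their number plus the rank of
     [A] is at most n. *)
  by have := mulmx0_rank_max PA; rewrite (eqP Pfree).
have [P Pfree PA] : exists2 P : 'M[K]_(d.+1, n), row_free P & P *m A = 0.
  (* The first d+1 vectors of a basis of the left kernel, whose dimension n - rank A is at least
     d+1. *)
  exists (pid_mx d.+1 *m row_base (kermx A)).
    rewrite /row_free mxrankMfree ?row_base_free // rank_pid_mx //.
    by rewrite mxrank_ker leq_subRL ?rank_leq_row // addnC.
  by apply/sub_kermxP; rewrite (submx_trans (submxMl _ _)) ?eq_row_base.
have [u [u1 ulam]] := H1_extend presG comm_rel lam.
have [b bP] := fin_all_exists (fun i => H1_extend presG comm_rel (row i P)).
have b1 i : H1 (b i) by case: (bP i).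
have PE : \matrix_i H1_coord x (b i) = P.
  by apply/row_matrixP => i; rewrite rowK; case: (bP i).
have span1 a : H1 (fun g => \sum_i a i * b i g) by apply: H1_sum.
have H1_eq (f g : G -> K) : f =1 g -> H1 g -> H1 f.
  by move=> fg g1 h k; rewrite /bar_delta1 !fg; apply: g1.
exists u; split=> //; split=> //.
(* W is the span of the cocycles whose coordinates are the rows of [P]. *)
exists (fun w => exists a : 'I_d.+1 -> K, forall g, w g = \sum_i a i * b i g).
split=> [w [a wE]||w [a wE]]; first exact: H1_eq wE (span1 a).
  exists b; split=> // a a0 i.
  have : H1_coord x (fun g => \sum_i a i * b i g) = 0.
    by apply/rowP => j; rewrite !mxE a0.
  rewrite H1_coord_sum PE => /eqP; rewrite mulmx_free_eq0 // => /eqP/rowP/(_ i).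
  by rewrite !mxE.
have w1 := H1_eq _ _ wE (span1 a).
apply/(H2_zero_cup presG comm_rel u1 w1).
have -> : H1_coord x w = H1_coord x (fun g => \sum_i a i * b i g).
  by apply/rowP => j; rewrite !mxE wE.
by rewrite H1_coord_sum PE ulam -mulmxA PA mulmx0.
Qed.
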